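(* Fix $\mathbf{A}\in\mathcal{B}^{\mathbb{C}}$. Let $\lambda_*$ be a simple eigenvalue of a self-adjoint discrete Sturm-Liouville problem $(\boldsymbol{\omega},\mathbf{A})=((1/f,q,w),\mathbf{A})$, $y=\{y_n\}_{n=0}^{N+1}$ a normalized eigenfunction for $\lambda_*$, and $\Lambda$ the continuous simple eigenvalue branch over $\Omega_N^{\mathbb{R},+}$ through $\lambda_*$. Then $$d\Lambda\big|_{\boldsymbol{\omega}}(h,k,l)=-\sum_{n=0}^{N-1}|f_n\Delta y_n|^2h_n+\sum_{n=1}^N|y_n|^2k_n-\lambda_*\sum_{n=1}^N|y_n|^2l_n$$ for all $(h,k,l)=\big((h_0,\dots,h_N),(k_1,\dots,k_N),(l_1,\dots,l_N)\big)\in T_{\boldsymbol{\omega}}\Omega_N^{\mathbb{R},+}=\mathbb{R}^{N+1}\times\mathbb{R}^N\times\mathbb{R}^N$.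
   Context: $N\ge2$ is an integer, $\Delta y_n=y_{n+1}-y_n$, $\nabla y_n=y_n-y_{n-1}$. A discrete Sturm-Liouville equation $-\nabla(f_n\Delta y_n)+q_ny_n=\lambda w_ny_n$, $1\le n\le N$, is identified with $\boldsymbol{\omega}=(1/f,q,w)=(1/f_0,\dots,1/f_N,q_1,\dots,q_N,w_1,\dots,w_N)$; $\Omega_N^{\mathbb{R},+}$ is the open subset of $\mathbb{R}^{3N+1}$ of such real triples with all $f_n\ne0$ and all $w_n>0$ (so the coordinates are $1/f_n$, $q_n$, $w_n$). A boundary condition is $A\begin{pmatrix}y_0\\ f_0\Delta y_0\end{pmatrix}+B\begin{pmatrix}y_N\\ f_N\Delta y_N\end{pmatrix}=0$ with $A,B$ complex $2\times2$ matrices, $\mathrm{rank}(A,B)=2$, denoted $\mathbf{A}=[A\,|\,B]$ (up to left multiplication of $(A,B)$ by $GL(2,\mathbb{C})$). $\mathcal{B}^{\mathbb{C}}$ is the space of self-adjoint boundary conditions, i.e. those with $AEA^*=BEB^*$, $E=\begin{pmatrix}0&1\\-1&0\end{pmatrix}$. The problem is self-adjoint if $\boldsymbol{\omega}\in\Omega_N^{\mathbb{R},+}$ and $\mathbf{A}\in\mathcal{B}^{\mathbb{C}}$. A number $\lambda$ is an eigenvalue of the problem if there is a nonzero complex sequence $y=\{y_n\}_{n=0}^{N+1}$ (an eigenfunction) satisfying both the equation and the boundary condition; for self-adjoint problems eigenvalues are real. An eigenfunction is normalized if $\sum_{n=1}^Nw_n|y_n|^2=1$. Let $\phi(\lambda),\psi(\lambda)$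 be the solutions of the equation with $\phi_0=1$, $f_0\Delta\phi_0=0$, $\psi_0=0$, $f_0\Delta\psi_0=1$, and $\Phi_N(\lambda)=\begin{pmatrix}\phi_N&\psi_N\\ f_N\Delta\phi_N&f_N\Delta\psi_N\end{pmatrix}$; an eigenvalue is simple if it is a zero of order $1$ of the polynomial $\Gamma(\lambda)=\det(A+B\Phi_N(\lambda))$. The continuous simple eigenvalue branch over $\Omega_N^{\mathbb{R},+}$ through $\lambda_*$ ($\mathbf{A}$ fixed): a continuous real function $\Lambda$ on a connected neighborhood of $\boldsymbol{\omega}$ in $\Omega_N^{\mathbb{R},+}$ with $\Lambda(\boldsymbol{\omega})=\lambda_*$ such that $\Lambda(\boldsymbol{\sigma})$ is a simple eigenvalue of $(\boldsymbol{\sigma},\mathbf{A})$ for each $\boldsymbol{\sigma}$ in that neighborhood (it exists and is locally unique). *)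

(* Defs.v *)
From HB Require Import structures.
From mathcomp Require Import all_boot all_order all_algebra.
From mathcomp Require Import sesquilinear spectral complex.
From mathcomp Require Import all_classical all_reals all_analysis.

Set Implicit Arguments.
Unset Strict Implicit.
Unset Printing Implicit Defensive.

Import Order.TTheory GRing.Theory Num.Theory.
Import numFieldNormedType.Exports.
Import ComplexField.Normc.

Local Open Scope classical_set_scope.
Local Open Scope ring_scope.
Local Open Scope complex_scope.
Local Open Scope sesquilinear_scope.

(* The ambient space R^(N+1) * R^N * R^N of (1/f, q, w), with the product
   (sup-norm) topology. *)
Notation slspace R N := ('rV[R]_N.+1 * 'rV[R]_N * 'rV[R]_N)%type.

Section DiscreteSturmLiouville.
Context {R : realType}.
Local Notation C := R[i].

(* The value 0 outside the range n < m is never used below. *)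
Definition vcoord m (v : 'rV[R]_m) (n : nat) : R := oapp (v 0) 0 (insub n).

(* The vectors q and w have indices 1, ..., N in the mathematics and
   0, ..., N-1 as elements of 'rV_N. *)
Definition vcoord1 m (v : 'rV[R]_m) (n : nat) : R := vcoord v n.-1.

Section Problem.
Variable N : nat.
Implicit Types (om : slspace R N) (y : nat -> C) (z : C) (A B : 'M[C]_2).

Definition rcoef om n : R := vcoord om.1.1 n.
Definition fcoef om n : R := (rcoef om n)^-1.
Definition qcoef om n : R := vcoord1 om.1.2 n.
Definition wcoef om n : R := vcoord1 om.2 n.

Definition Omega : set (slspace R N) :=
  [set om | (forall n, (n <= N)%N -> rcoef om n != 0) /\
            (forall n, (1 <= n <= N)%N -> 0 < wcoef om n)].

(* A sequence y_0, ..., y_(N+1) is represented by a function on nat of which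
   only these values matter. *)
Definition quasidiff om y n : C := (fcoef om n)%:C * (y n.+1 - y n).

Definition sl_equation om z y : Prop :=
  forall n, (1 <= n <= N)%N ->
    - (quasidiff om y n - quasidiff om y n.-1) + (qcoef om n)%:C * y n
    = z * (wcoef om n)%:C * y n.

Definition mx2 (K : Type) (a b c d : K) : 'M[K]_2 :=
  \matrix_(i, j) if i == 0 then (if j == 0 then a else b)
                 else (if j == 0 then c else d).

Definition bvec om y n : 'cV[C]_2 :=
  \col_i if i == 0 then y n else quasidiff om y n.

(* The pair (A, B) stands for its class [A | B] under left multiplication by
   GL(2, C); the notions below do not depend on the representative. *)
Definition boundary_condition om A B y : Prop :=
  A *m bvec om y 0%N + B *m bvec om y N = 0.

Definition selfadjoint_bc A B : Prop :=
  \rank (row_mx A B) = 2%N /\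
  let E := mx2 0 1 (-1) 0 in A *m E *m A ^t* = B *m E *m B ^t*.

Definition eigenfunction om A B z y : Prop :=
  [/\ exists2 n, (n <= N.+1)%N & y n != 0,
      sl_equation om z y & boundary_condition om A B y].

Definition sl_eigenvalue om A B z : Prop := exists y, eigenfunction om A B z y.

Definition normalized om y : Prop :=
  \sum_(1 <= n < N.+1) wcoef om n * normc (y n) ^+ 2 = 1.

(* The pair (y_n, f_n (y_(n+1) - y_n)), as polynomials in the spectral
   parameter 'X, for the solution of the equation with y_0 = a and
   f_0 (y_1 - y_0) = b: the equation at n reads
   f_n Dy_n = f_(n-1) Dy_(n-1) + (q_n - 'X w_n) y_n. *)
Fixpoint ivp om (a b : C) (n : nat) : {poly C} * {poly C} :=
  if n is m.+1 then
    let y := (ivp om a b m).1 + (rcoef om m)%:C *: (ivp om a b m).2 in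
    (y, (ivp om a b m).2
        + ((qcoef om m.+1)%:C%:P - (wcoef om m.+1)%:C *: 'X) * y)
  else (a%:P, b%:P).

Definition phi om n : {poly C} := (ivp om 1 0 n).1.
Definition psi om n : {poly C} := (ivp om 0 1 n).1.

Definition PhiN om : 'M[{poly C}]_2 :=
  mx2 (phi om N) (psi om N)
      ((fcoef om N)%:C *: (phi om N.+1 - phi om N))
      ((fcoef om N)%:C *: (psi om N.+1 - psi om N)).

Definition Gamma om A B : {poly C} :=
  \det (map_mx polyC A + map_mx polyC B *m PhiN om).

(* mup z 0 = 0, so this forces Gamma to be a nonzero polynomial. *)
Definition simple_eigenvalue om A B z : Prop :=
  sl_eigenvalue om A B z /\ mup z (Gamma om A B) = 1%N.

(* As Omega is open, neighborhoods of om in Omega are the neighborhoods of om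
   in the ambient space that are contained in Omega. *)
Definition simple_eigenvalue_branch A B om (lam : R) (U : set (slspace R N))
    (Lambda : slspace R N -> R) : Prop :=
  [/\ nbhs om U /\ U `<=` Omega,
      connected U,
      {within U, continuous Lambda},
      Lambda om = lam &
      forall sg, U sg -> simple_eigenvalue sg A B (Lambda sg)%:C].

Lemma quasidiff_ivp om (a b z : C) n : Omega om -> (n <= N)%N ->
  quasidiff om (fun k => (ivp om a b k).1.[z]) n = (ivp om a b n).2.[z].
Proof.
move=> [r0 _] /r0 rn0; rewrite /quasidiff /= hornerD hornerZ addrC addKr.
by rewrite mulrA -rmorphM mulVf // mul1r.
Qed.

Lemma ivp_solution om (a b z : C) (y := fun k => (ivp om a b k).1.[z]) :
  Omega om -> [/\ sl_equation om z y, y 0%N = a & quasidiff om y 0%N = b].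
Proof.
move=> Oom; split; last 2 first.
- by rewrite /y /= hornerC.
- by rewrite quasidiff_ivp //= hornerC.
case=> // n /andP[_ nN] /=; rewrite !quasidiff_ivp //; last exact: ltnW.
rewrite [(ivp _ _ _ n.+1).2]/= -/(y n.+1) hornerD hornerM hornerD hornerN.
rewrite hornerC hornerZ hornerX addrC [X in - (X - _)]addrC addrK.
by rewrite -[_ + _ *: _]/(ivp om a b n.+1).1 -/(y n.+1) mulrBl opprB addrC
           subrK [z * _]mulrC.
Qed.

Lemma horner_Gamma om A B z : (Gamma om A B).[z] =
  \det (A + B *m map_mx (horner^~ z) (PhiN om)).
Proof.
rewrite /Gamma -[LHS]/(horner_eval z _) -det_map_mx map_mxD map_mxM.
have polyCK (M : 'M[C]_2) : map_mx (horner_eval z) (map_mx polyC M) = M.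
  by apply/matrixP=> i j; rewrite !mxE /horner_eval hornerC.
by rewrite !polyCK.
Qed.

End Problem.
End DiscreteSturmLiouville.

(* Main.v *)
Require Import Defs.
From HB Require Import structures.
From mathcomp Require Import all_boot all_order all_algebra.
From mathcomp Require Import sesquilinear spectral complex.
From mathcomp Require Import all_classical all_reals all_analysis.
From mathcomp Require Import ring lra.

Set Implicit Arguments.
Unset Strict Implicit.
Unset Printing Implicit Defensive.

Import Order.TTheory GRing.Theory Num.Theory.
Import numFieldNormedType.Exports.
Import ComplexField.Normc.

Local Open Scope classical_set_scope.
Local Open Scope ring_scope.
Local Open Scope complex_scope.

(** The formula comes from the Lagrange identity for two different problems.
    Let [sg] be close to [om], let [mu = Lambda sg], and let [u] be a solution of
    [(sg, mu)] that satisfies the boundary condition, with quasi-difference [v].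
    Summing the discrete derivative of
      conj y_n * v_n - conj (f_n (y_(n+1) - y_n)) * u_n
    over 1 <= n <= N gives two boundary terms, and these cancel because both
    [y] and [u] lie in the Lagrangian subspace defined by a self-adjoint boundary
    condition ([selfadjoint_bc_form]).  What remains ([eigenvalue_increment]) is
    the exact identity
      (mu - lam) * S(sg) = (a linear form in sg - om, with coefficients
                            depending on sg),
    where S(sg) is the sum of w'_n * Re (conj y_n * u_n), w' being the weight of
    [sg].

    If [u] can be chosen so that it tends to [y] as [sg] tends to [om], then S(sg)
    tends to the squared norm of [y], which is 1, the coefficients of the linear
    form tend to those of the claimed differential, and a Caratheodory
    criterion ([diff_moving_coordform]) yields differentiability at once: no
    implicit function theorem is involved.

    Simplicity of the eigenvalue is what makes this choice of [u] possible.  The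
    initial data of [u] must lie in the kernel of the singular 2 x 2 matrix
    [A + B * transfer sg mu].  At [om] this matrix is not zero, since otherwise
    its determinant would have a double root ([simple_root_det_neq0]); so one
    of its rows is not zero, and the vector orthogonal to the same row of the
    matrix of [sg] is a kernel vector that depends continuously on [sg]
    ([cvg_initial_data]). *)

(** * Differentiability from a moving linear form *)

Section Caratheodory.
Context {R : realType} {V W : normedModType R}.

(** Caratheodory's criterion: the increment may be written with a map [E s] that
    moves with [s]; if [E s] tends to [D] in operator norm, then
    [E s (s - x) - D (s - x)] is negligible with respect to [s - x]. *)
Lemma caratheodory_diff (f : V -> W) (x : V) (E : V -> V -> W)
    (D : {linear V -> W}) :
    continuous D ->
    (\forall s \near x, f s - f x = E s (s - x)) ->
    (forall e : R, 0 < e ->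
       \forall s \near x, forall v, `|E s v - D v| <= e * `|v|) ->
  differentiable f x /\ 'd f x = D :> (V -> W).
Proof.
move=> Dc fE ED.
have fD : f \o shift x = cst (f x) + D +o_ 0 id.
  apply/eqaddoP => e e0.
  have small : \forall s \near x, `|f s - f x - D (s - x)| <= e * `|s - x|.
    by near=> s; rewrite (near fE s) //; near: s; apply: filterS (ED e e0).
  rewrite /= near_simpl; move: small; rewrite (near_shift 0) subr0.
  apply: filterS => h /=; rewrite addrK.
  by rewrite !fctE /= opprD addrA.
have dfD := diff_unique Dc fD.
split => //; apply/diff_locallyP; rewrite dfD; split.
Unshelve. all: by end_near. Qed.
End Caratheodory.

Section CoordinateForms.
Context {R : realType}.

Lemma vcoord_linear m (n : nat) (t : R) (u v : 'rV[R]_m) :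
  vcoord (t *: u + v) n = t * vcoord u n + vcoord v n.
Proof.
rewrite /vcoord; case: insubP => [i _ _|_] /=; first by rewrite !mxE.
by rewrite mulr0 addr0.
Qed.

Lemma vcoordB m (n : nat) (u v : 'rV[R]_m) :
  vcoord (u - v) n = vcoord u n - vcoord v n.
Proof. by rewrite addrC -scaleN1r vcoord_linear mulN1r addrC. Qed.

Lemma norm_vcoord m (n : nat) (v : 'rV[R]_m) : `|vcoord v n| <= `|v|.
Proof.
rewrite /vcoord; case: insubP => [i _ _|_] /=; last by rewrite normr0.
rewrite [leRHS]mx_normrE.
exact: (le_bigmax _ (fun ij : 'I_1 * 'I_m => `|v ij.1 ij.2|) (0, i)).
Qed.

Variable N : nat.
Implicit Types (v : slspace R N) (a b c : nat -> R).

(** The first sum ends at [N - 1], as in the theorem: [f_N] enters the boundary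
    condition only through the quasi-difference at [N], which the equation
    expresses by [y_N] and the quasi-difference at [N - 1]. *)
Definition coordform a b c v : R :=
  \sum_(0 <= n < N) a n * vcoord v.1.1 n
  + \sum_(1 <= n < N.+1) b n * vcoord1 v.1.2 n
  + \sum_(1 <= n < N.+1) c n * vcoord1 v.2 n.

Lemma coordform_linear a b c : linear (coordform a b c).
Proof.
move=> t u v; rewrite [X in _ = X + _](_ : _ = t * coordform a b c u) //.
rewrite /coordform 2!mulrDr 3!mulr_sumr.
rewrite addrACA [X in _ = X + _]addrACA -!big_split /=.
by congr (_ + _ + _); apply: eq_bigr => n _; rewrite /vcoord1 vcoord_linear; ring.
Qed.

HB.instance Definition _ a b c :=
  GRing.isLinear.Build R (slspace R N) R _ (coordform a b c)
    (coordform_linear a b c).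

Lemma coordformB a b c a' b' c' v :
  coordform a b c v - coordform a' b' c' v =
  coordform (a \- a') (b \- b') (c \- c') v.
Proof.
rewrite /coordform 2!opprD addrACA [X in X + _ = _]addrACA -!sumrN -!big_split.
by congr (_ + _ + _); apply: eq_bigr => n _ /=; rewrite mulrBl.
Qed.

Lemma coordformZ a b c (t : R) v :
  t * coordform a b c v =
  coordform (fun n => t * a n) (fun n => t * b n) (fun n => t * c n) v.
Proof.
rewrite /coordform 2!mulrDr 3!mulr_sumr.
by congr (_ + _ + _); apply: eq_bigr => n _; rewrite mulrA.
Qed.

(** An upper bound for the operator norm of [coordform a b c]. *)
Definition coordsize a b c : R :=
  \sum_(0 <= n < N) `|a n| + \sum_(1 <= n < N.+1) `|b n|
  + \sum_(1 <= n < N.+1) `|c n|.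

Lemma norm_coordform a b c v :
  `|coordform a b c v| <= coordsize a b c * `|v|.
Proof.
have n1 : `|v.1.1| <= `|v| by rewrite !prod_normE !le_max lexx.
have n2 : `|v.1.2| <= `|v| by rewrite !prod_normE !le_max lexx orbT.
have n3 : `|v.2| <= `|v| by rewrite !prod_normE !le_max lexx orbT.
rewrite /coordsize 2!mulrDl 3!mulr_suml.
rewrite (le_trans (ler_normD _ _))// lerD// ?(le_trans (ler_normD _ _))// ?lerD//;
  rewrite (le_trans (ler_norm_sum _ _ _))// ler_sum// => n _; rewrite normrM;
  by rewrite ler_wpM2l// (le_trans (norm_vcoord _ _)).
Qed.

Lemma coordform_continuous a b c : continuous (coordform a b c).
Proof.
apply: bounded_linear_continuous; rewrite /bounded_near.
near=> M; near=> v => /=; apply: (le_trans (norm_coordform _ _ _ _)).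
apply: (@le_trans _ _ (coordsize a b c)); last first.
  by near: M; apply: nbhs_pinfty_ge; rewrite num_real.
rewrite ler_piMr ?addr_ge0 ?sumr_ge0 //.
Unshelve. all: by end_near. Qed.

Lemma cvg_coordsize0 (x : slspace R N) (a b c : slspace R N -> nat -> R) :
  (forall n, a s n @[s --> x] --> a x n) ->
  (forall n, b s n @[s --> x] --> b x n) ->
  (forall n, c s n @[s --> x] --> c x n) ->
  coordsize (a s \- a x) (b s \- b x) (c s \- c x) @[s --> x] --> (0 : R).
Proof.
move=> ac bc cc.
have sum0 (d : slspace R N -> nat -> R) i j :
    (forall n, d s n @[s --> x] --> d x n) ->
    (\sum_(i <= n < j) `|(d s \- d x) n|) @[s --> x] --> (0 : R).
  move=> dc; rewrite [X in _ --> X](_ : _ = \sum_(i <= n < j) 0 :> R);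
    last by rewrite big1.
  apply: cvg_big => [|n _]; first exact: add_continuous.
  rewrite -(normr0 R) -(subrr (d x n)); apply: cvg_norm.
  by apply: cvgB; [exact: dc|exact: cvg_cst].
rewrite -(addr0 (0 : R)) -[X in X + _]addr0.
by apply: cvgD; [apply: cvgD|]; exact: sum0.
Qed.

(** The continuity of the finitely many coefficients is turned into the
    uniform bound of Caratheodory's criterion through [coordsize]. *)
Lemma diff_moving_coordform (f : slspace R N -> R) (x : slspace R N)
    (a b c : slspace R N -> nat -> R) :
  (forall n, a s n @[s --> x] --> a x n) ->
  (forall n, b s n @[s --> x] --> b x n) ->
  (forall n, c s n @[s --> x] --> c x n) ->
  (\forall s \near x, f s - f x = coordform (a s) (b s) (c s) (s - x)) ->
  differentiable f x /\ 'd f x = coordform (a x) (b x) (c x) :> (_ -> _).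
Proof.
move=> ac bc cc fE.
apply: (@caratheodory_diff _ _ _ _ _ (fun s => coordform (a s) (b s) (c s))).
- exact: coordform_continuous.
- exact: fE.
move=> e e0; have /cvgr0_norm_le := cvg_coordsize0 ac bc cc; move=> /(_ e e0).
apply: filterS => s small v; rewrite coordformB.
apply: (le_trans (norm_coordform _ _ _ _)); rewrite ler_wpM2r //.
exact: le_trans (ler_norm _) small.
Qed.

End CoordinateForms.

Section CoefficientContinuity.
Context {R : realType} {N : nat}.

Lemma cvg_of_contraction (V : normedModType R) (f : V -> R) (x : V) :
  (forall s, `|f s - f x| <= `|s - x|) -> f s @[s --> x] --> f x.
Proof.
move=> lip; apply/cvgrPdist_le => e e0.
have: \forall s \near x, `|x - s| <= e by apply: cvgr_dist_le.
by apply: filterS => s; apply: le_trans; rewrite distrC [leRHS]distrC.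
Qed.

Lemma rcoef_cvg (om : slspace R N) n : rcoef s n @[s --> om] --> rcoef om n.
Proof.
apply: cvg_of_contraction => s; rewrite -vcoordB (le_trans (norm_vcoord _ _)) //.
by rewrite !prod_normE !le_max lexx.
Qed.

Lemma qcoef_cvg (om : slspace R N) n : qcoef s n @[s --> om] --> qcoef om n.
Proof.
apply: cvg_of_contraction => s; rewrite -vcoordB (le_trans (norm_vcoord _ _)) //.
by rewrite !prod_normE !le_max lexx orbT.
Qed.

Lemma wcoef_cvg (om : slspace R N) n : wcoef s n @[s --> om] --> wcoef om n.
Proof.
apply: cvg_of_contraction => s; rewrite -vcoordB (le_trans (norm_vcoord _ _)) //.
by rewrite !prod_normE !le_max lexx orbT.
Qed.
End CoefficientContinuity.

(** * Real and complex limits *)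

Section ComplexConvergence.
Context {R : realType} {T : Type} {F : set_system T} {FF : Filter F}.
(* With this cast, the topology of the complex numbers is found through their
   structure of numeric field. *)
Local Notation C := (R[i] : numClosedFieldType).

Lemma cvg_real_complex (f : T -> R) (a : R) :
  f t @[t --> F] --> a -> ((f t)%:C : C) @[t --> F] --> (a%:C : C).
Proof.
move=> /cvgrPdist_lt fa; apply/cvgrPdist_lt => e e0.
have er : e = (complex.Re e)%:C by rewrite RRe_real // gtr0_real.
move: e0; rewrite er ltcR => /fa; apply: filterS => t.
by rewrite -rmorphB normc_def /= expr0n addr0 sqrtr_sqr ltcR.
Qed.

Lemma cvg_complex_Re (f : T -> C) (a : C) :
  f t @[t --> F] --> a -> complex.Re (f t) @[t --> F] --> complex.Re a.
Proof.
move=> /cvgrPdist_lt fa; apply/cvgrPdist_lt => e e0.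
have /fa : 0 < e%:C by rewrite ltcR.
apply: filterS => t; rewrite -ltcR; apply: le_lt_trans.
by have := normc_ge_Re (a - f t); case: (a) (f t) => [? ?] [? ?].
Qed.

Lemma Re_conj_mul (x : C) :
  complex.Re (conjc x * x) = normc x ^+ 2.
Proof.
by case: x => a b; rewrite /= sqr_sqrtr ?addr_ge0 ?sqr_ge0 // mulNr opprK -!expr2.
Qed.

End ComplexConvergence.

(** * Matrices of order 2 *)

Lemma ord2P (P : 'I_2 -> Prop) : P 0 -> P 1 -> forall i, P i.
Proof.
move=> P0 P1 i; have [->//|->//] : i = 0 \/ i = 1.
by case: i => [[|[|//]] h]; [left|right]; apply: val_inj.
Qed.

Lemma ord2_lift : lift ord0 ord0 = 1 :> 'I_2.
Proof. exact: val_inj. Qed.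

Lemma det22 (K : comNzRingType) (M : 'M[K]_2) :
  \det M = M 0 0 * M 1 1 - M 0 1 * M 1 0.
Proof.
rewrite (expand_det_row _ 0) !big_ord_recl big_ord0 addr0 ord2_lift /cofactor.
rewrite !det_mx11 !mxE /= !expr0 expr1 mul1r mulN1r mulrN.
by congr (_ * M _ _ - _ * M _ _); apply: val_inj.
Qed.

Section SingularMatrix2.
Variable F : fieldType.

Definition row_perp (M : 'M[F]_2) (i : 'I_2) : 'cV[F]_2 :=
  \col_j if j == 0 then - M i 1 else M i 0.

Lemma mul_row_perp (M : 'M[F]_2) i : \det M = 0 -> M *m row_perp M i = 0.
Proof.
rewrite det22 => /eqP; rewrite subr_eq0 => /eqP detM.
apply/matrixP=> k j; rewrite !mxE !big_ord_recl big_ord0 !mxE /= addr0.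
rewrite ord2_lift.
by move: i k; do 2!apply: ord2P; rewrite ?mulrN; apply/eqP;
  rewrite addrC subr_eq0 mulrC // detM mulrC.
Qed.

(** With [mul_row_perp], this gives a formula for the kernel of a singular
    matrix of order 2 that is polynomial in its entries, hence continuous. *)
Lemma kernel_row_perp (M : 'M[F]_2) i (c : 'cV[F]_2) :
  row i M != 0 -> M *m c = 0 -> exists t, c = t *: row_perp M i.
Proof.
move=> Mi0 /matrixP /(_ i 0); rewrite !mxE !big_ord_recl big_ord0 addr0.
rewrite ord2_lift.
move=> /eqP; rewrite addr_eq0 => /eqP kerE.
have colP2 t : c 0 0 = t * - M i 1 -> c 1 0 = t * M i 0 -> c = t *: row_perp M i.
  move=> c0 c1; apply/matrixP => k j; rewrite ord1 !mxE.
  by move: k; apply: ord2P.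
have [m0|m0] := eqVneq (M i 0) 0.
  have m1 : M i 1 != 0.
    apply: contra_neq Mi0 => m1; apply/matrixP => k j; rewrite !mxE.
    by move: j; apply: ord2P.
  exists (- c 0 0 / M i 1); apply: colP2; first by field.
  move: kerE; rewrite m0 mul0r mulr0 => /esym/eqP.
  by rewrite oppr_eq0 mulf_eq0 (negPf m1) => /eqP.
exists (c 1 0 / M i 0); apply: colP2; last by field.
by apply: (mulfI m0); rewrite kerE; field.
Qed.

(** If all entries vanish at [z], then each of them is divisible by ['X - z], and
    the determinant, a form of degree 2 in them, by the square of it. *)
Lemma simple_root_det_neq0 (M : 'M[{poly F}]_2) z :
  mup z (\det M) = 1%N -> map_mx (horner^~ z) M != 0.
Proof.
move=> mu1; apply/eqP => M0.
have detM0 : \det M != 0.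
  (* [mup z 0] is 0, because [mup z q] is an element of ['I_(size q).+1]. *)
  apply: contra_eq_neq mu1 => ->; rewrite neq_ltn [X in X || _]/=.
  by rewrite /mup (leq_trans (ltn_ord _)) // size_poly0.
have: (2 <= mup z (\det M))%N; last by rewrite mu1.
have div i j : ('X - z%:P) %| M i j.
  by rewrite dvdp_XsubCl; apply/rootP; move/matrixP: M0 => /(_ i j); rewrite !mxE.
by rewrite mup_geq // det22 expr2 dvdp_sub // dvdp_mul.
Qed.
End SingularMatrix2.

(** * Self-adjoint boundary conditions *)

Section LagrangianBoundary.
Context {R : realType}.
Local Notation C := R[i].
Local Open Scope sesquilinear_scope.

(** Write D = (A, B) and J = diag (E, - E).  The self-adjointness condition says
    that D J D^* = 0, so that the range of J D^* lies in the kernel of D; both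
    have dimension 2, as D has rank 2 and J is invertible, and so they are equal.
    For X = J D^* z and X' in the kernel of D, the form X^* J X' is then
    z^* D J^T J X' = z^* D X' = 0. *)
Lemma selfadjoint_bc_form (A B : 'M[C]_2) (a b c d : 'cV[C]_2) :
  selfadjoint_bc A B -> A *m a + B *m b = 0 -> A *m c + B *m d = 0 ->
  a ^t* *m mx2 0 1 (-1) 0 *m c = b ^t* *m mx2 0 1 (-1) 0 *m d.
Proof.
set E : 'M[C]_2 := mx2 0 1 (-1) 0 => -[rkAB] /= AEB Kab Kcd.
have ET : E^T = - E.
  by apply/matrixP; do 2!apply: ord2P; rewrite !mxE /= ?oppr0 ?opprK.
have Econj : map_mx Num.conj E = E.
  apply/matrixP; do 2!apply: ord2P; rewrite !mxE /= ?rmorph0 ?rmorph1 //.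
  by rewrite rmorphN rmorph1.
have EE : E *m E = - 1%:M.
  apply/matrixP; do 2!apply: ord2P;
  rewrite !mxE !big_ord_recl big_ord0 !mxE /= !mul0r;
  by rewrite ?mulr0 ?mulr1 ?mul1r ?add0r ?addr0 ?oppr0.
pose D := row_mx A B.
pose J : 'M[C]_(2 + 2) := block_mx E 0 0 (- E).
have JT : J^T = - J by rewrite tr_block_mx !trmx0 linearN /= ET opp_block_mx !oppr0.
have JJ : J *m J = - 1%:M.
  rewrite mulmx_block !mul0mx !mulmx0 !mulNmx !mulmxN opprK EE !addr0 !add0r.
  by rewrite (scalar_mx_block 2 2) opp_block_mx !oppr0.
have JTJ : J^T *m J = 1%:M by rewrite JT mulNmx JJ opprK.
have Jconj : map_mx Num.conj J = J.
  by rewrite map_block_mx map_mxN Econj !map_mx0.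
have JTfree : row_free J^T by rewrite row_free_unit; have [] := mulmx1_unit JTJ.
pose cD := map_mx Num.conj D.
pose G := cD *m J^T.
have GDT : G *m D^T = 0.
  have DJD : D *m J *m cD^T = 0.
    rewrite /D mul_row_block !mulmx0 addr0 add0r mulmxN /cD map_row_mx.
    by rewrite tr_row_mx mul_row_col mulNmx !map_trmx AEB subrr.
  by move/(congr1 trmx): DJD; rewrite !trmx_mul trmxK trmx0 mulmxA.
(* Rows are the native vectors for subspaces, hence the transpositions. *)
have kerG (X : 'cV[C]_(2 + 2)) : D *m X = 0 -> exists z, X^T = z *m G.
  move=> DX; apply/submxP.
  have XK : (X^T <= kermx D^T)%MS.
    by apply/sub_kermxP; rewrite -trmx_mul DX trmx0.
  have GK : (G <= kermx D^T)%MS by apply/sub_kermxP.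
  rewrite (submx_trans XK) // -(mxrank_leqif_sup GK).
  by rewrite mxrank_ker mxrank_tr rkAB mxrankMfree // mxrank_map rkAB.
have [|z Xz] := kerG (col_mx a b); first by rewrite mul_row_col.
have : (col_mx a b) ^t* *m J *m col_mx c d = 0.
  rewrite Xz map_mxM map_mxM -map_mx_comp.
  rewrite (_ : map_mx _ D = D); last first.
    by apply/matrixP => i j; rewrite !mxE /= conjCK.
  rewrite -map_trmx Jconj -!mulmxA [J^T *m _]mulmxA JTJ mul1mx.
  by rewrite mul_row_col Kcd mulmx0.
rewrite tr_col_mx map_row_mx mul_row_block !mulmx0 addr0 add0r mul_row_col.
by rewrite mulmxN mulNmx => /eqP; rewrite subr_eq0 => /eqP.
Qed.
End LagrangianBoundary.

(** * Solutions of the equation *)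

(** The Lagrange identity for two first-order systems with different
    coefficients, free of conjugations: it is applied to the conjugate of the
    eigenfunction, which solves the same real problem. *)
Lemma green_identity (K : comPzRingType) (N : nat)
    (r s Q Q' y p u v : nat -> K) :
  (forall n, (n < N)%N -> y n.+1 = y n + r n * p n) ->
  (forall n, (n < N)%N -> p n.+1 = p n + Q n.+1 * y n.+1) ->
  (forall n, (n < N)%N -> u n.+1 = u n + s n * v n) ->
  (forall n, (n < N)%N -> v n.+1 = v n + Q' n.+1 * u n.+1) ->
  (y N * v N - p N * u N) - (y 0%N * v 0%N - p 0%N * u 0%N) =
  \sum_(1 <= n < N.+1) (Q' n - Q n) * (y n * u n)
  - \sum_(0 <= n < N) (s n - r n) * (p n * v n).
Proof.
elim: N => [|N IH] yE pE uE vE; first by rewrite !big_geq // !subrr.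
rewrite big_nat_recr // [X in _ = _ - X]big_nat_recr //=.
have lt n : (n < N -> n < N.+1)%N := @ltn_trans N n N.+1 ^~ (ltnSn N).
have := IH (fun n h => yE n (lt n h)) (fun n h => pE n (lt n h))
           (fun n h => uE n (lt n h)) (fun n h => vE n (lt n h)).
rewrite pE // vE // yE // uE //.
move: (\sum_(_ <= n < _) _) (\sum_(_ <= n < _) _) => S T e.
rewrite [in RHS]opprD [RHS]addrACA -e; ring.
Qed.

Section Solutions.
Context {R : realType} {N : nat}.
Local Notation C := (R[i] : numClosedFieldType).
Implicit Types (om : slspace R N) (y : nat -> C) (z a b : C).

(** The two components of the initial value problem, evaluated at [z].  Their
    type is a numeric field, so that limits make sense for them. *)
Definition ivp_val om a b z n : C := (ivp om a b n).1.[z].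
Definition ivp_mom om a b z n : C := (ivp om a b n).2.[z].

Lemma ivp_val0 om a b z : ivp_val om a b z 0 = a.
Proof. by rewrite /ivp_val /= hornerC. Qed.

Lemma ivp_mom0 om a b z : ivp_mom om a b z 0 = b.
Proof. by rewrite /ivp_mom /= hornerC. Qed.

Lemma ivp_valS om a b z n : ivp_val om a b z n.+1 =
  ivp_val om a b z n + (rcoef om n)%:C * ivp_mom om a b z n.
Proof. by rewrite /ivp_val /= hornerD hornerZ. Qed.

Lemma ivp_momS om a b z n : ivp_mom om a b z n.+1 =
  ivp_mom om a b z n +
  ((qcoef om n.+1)%:C - z * (wcoef om n.+1)%:C) * ivp_val om a b z n.+1.
Proof.
rewrite /ivp_mom [X in X.[z]]/= -[_ + _ *: _]/(ivp om a b n.+1).1.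
by rewrite hornerD hornerM hornerD hornerN hornerZ hornerX hornerC [z * _]mulrC.
Qed.

Lemma ivp_lin om a b z n :
  ivp_val om a b z n =
    a * ivp_val om 1 0 z n + b * ivp_val om 0 1 z n /\
  ivp_mom om a b z n =
    a * ivp_mom om 1 0 z n + b * ivp_mom om 0 1 z n.
Proof.
elim: n => [|n [IH1 IH2]].
  by rewrite !ivp_val0 !ivp_mom0 !mulr0 !mulr1 addr0 add0r.
have E1 : ivp_val om a b z n.+1 =
    a * ivp_val om 1 0 z n.+1 + b * ivp_val om 0 1 z n.+1.
  by rewrite !ivp_valS IH1 IH2; ring.
by split=> //; rewrite !ivp_momS E1 IH2; ring.
Qed.

Lemma seq_quasidiff om y n : Omega om -> (n <= N)%N ->
  y n.+1 = y n + (rcoef om n)%:C * quasidiff om y n.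
Proof.
move=> [r0 _] /r0 rn0.
by rewrite /quasidiff mulrA -rmorphM mulfV // mul1r addrCA subrr addr0.
Qed.

Lemma quasidiff_step om z y n : sl_equation om z y -> (n < N)%N ->
  quasidiff om y n.+1 = quasidiff om y n +
    ((qcoef om n.+1)%:C - z * (wcoef om n.+1)%:C) * y n.+1.
Proof.
by move=> eqy nN; rewrite mulrBl -(eqy n.+1) //= opprB; ring.
Qed.

Lemma sl_equation_ivp om z y n : Omega om -> sl_equation om z y -> (n <= N)%N ->
  y n = ivp_val om (y 0%N) (quasidiff om y 0) z n /\
  quasidiff om y n = ivp_mom om (y 0%N) (quasidiff om y 0) z n.
Proof.
move=> Oom eqy; elim: n => [|n IH] nN; first by rewrite ivp_val0 ivp_mom0.
have [IH1 IH2] := IH (ltnW nN).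
have E1 : y n.+1 = ivp_val om (y 0%N) (quasidiff om y 0) z n.+1.
  by rewrite ivp_valS -IH1 -IH2 -seq_quasidiff // ltnW.
by split=> //; rewrite ivp_momS -IH2 -E1; exact: quasidiff_step.
Qed.

(** Evaluating [PhiN] at [z] gives this matrix ([horner_PhiN]), whose entries do not
    involve f_N. *)
Definition transfer om z : 'M[C]_2 :=
  mx2 (ivp_val om 1 0 z N) (ivp_val om 0 1 z N)
      (ivp_mom om 1 0 z N) (ivp_mom om 0 1 z N).

Lemma horner_PhiN om z : Omega om ->
  map_mx (horner^~ z) (PhiN om) = transfer om z.
Proof.
move=> Oom; apply/matrixP; do 2!apply: ord2P; rewrite !mxE //=.
- by rewrite hornerZ hornerD hornerN; exact: quasidiff_ivp.
- by rewrite hornerZ hornerD hornerN; exact: quasidiff_ivp.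
Qed.

Definition state (y p : C) : 'cV[C]_2 := \col_i if i == 0 then y else p.

Lemma transfer_ivp om a b z :
  state (ivp_val om a b z N) (ivp_mom om a b z N) = transfer om z *m state a b.
Proof.
have [E1 E2] := ivp_lin om a b z N.
apply/matrixP => i j; rewrite ord1 !mxE !big_ord_recl big_ord0 !mxE /=.
rewrite addr0; move: i.
by apply: ord2P; rewrite ?E1 ?E2 /= ![_ * a]mulrC ![_ * b]mulrC.
Qed.

Lemma bvec_state om y n : bvec om y n = state (y n) (quasidiff om y n).
Proof. by []. Qed.

Lemma cvg_ivp (a b z : slspace R N -> C) om :
  a s @[s --> om] --> a om -> b s @[s --> om] --> b om ->
  z s @[s --> om] --> z om ->
  forall n,
    ivp_val s (a s) (b s) (z s) n @[s --> om] --> ivp_val om (a om) (b om) (z om) n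
  /\ ivp_mom s (a s) (b s) (z s) n @[s --> om] --> ivp_mom om (a om) (b om) (z om) n.
Proof.
move=> ca cb cz; elim=> [|n [IH1 IH2]].
  split.
    rewrite ivp_val0.
    under eq_fun do rewrite ivp_val0.
    exact: ca.
  rewrite ivp_mom0.
  under eq_fun do rewrite ivp_mom0.
  exact: cb.
have c1 : ivp_val s (a s) (b s) (z s) n.+1 @[s --> om] -->
          ivp_val om (a om) (b om) (z om) n.+1.
  rewrite ivp_valS; under eq_fun do rewrite ivp_valS.
  apply: (cvgD IH1); apply: (cvgM _ IH2).
  by apply: cvg_real_complex; exact: rcoef_cvg.
split; first exact: c1.
rewrite ivp_momS; under eq_fun do rewrite ivp_momS.
apply: (cvgD IH2); apply: (cvgM _ c1); apply: cvgB.
  by apply: cvg_real_complex; exact: qcoef_cvg.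
apply: (cvgM cz).
by apply: cvg_real_complex; exact: wcoef_cvg.
Qed.
End Solutions.

(** * Perturbation of a simple eigenvalue *)

Section Perturbation.
Context {R : realType} {N : nat}.
Local Notation C := (R[i] : numClosedFieldType).
Implicit Types (A B : 'M[C]_2) (om sg : slspace R N) (y : nat -> C) (z a b : C).

(** Over [Omega], the determinant of this matrix is the value of [Gamma] at [z], and
    its kernel consists of the initial data of the solutions that satisfy the
    boundary condition. *)
Definition charmx A B om z : 'M[C]_2 := A + B *m transfer om z.

Lemma charmx_ivp A B om a b z :
  charmx A B om z *m state a b = 0 ->
  A *m state a b + B *m state (ivp_val om a b z N) (ivp_mom om a b z N) = 0.
Proof. by rewrite transfer_ivp mulmxA -mulmxDl. Qed.

Lemma simple_eigenvalue_charmx A B om z : Omega om ->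
  simple_eigenvalue om A B z -> \det (charmx A B om z) = 0 /\ charmx A B om z != 0.
Proof.
move=> Oom [_ mu1].
have mapE : map_mx (horner^~ z) (map_mx polyC A + map_mx polyC B *m PhiN om) =
    charmx A B om z.
  rewrite /charmx -horner_PhiN // -[horner^~ z]/(horner_eval z) map_mxD map_mxM.
  have polyCK (M : 'M[C]_2) : map_mx (horner_eval z) (map_mx polyC M) = M.
    by apply/matrixP=> i j; rewrite !mxE /horner_eval hornerC.
  by rewrite !polyCK.
split; last by rewrite -mapE; exact: simple_root_det_neq0.
rewrite /charmx -horner_PhiN // -horner_Gamma; apply/rootP.
by apply: contraT => /mupNroot; rewrite mu1.
Qed.

Lemma cvg_charmx A B (z : slspace R N -> C) om i j :
  z s @[s --> om] --> z om ->
  charmx A B s (z s) i j @[s --> om] --> charmx A B om (z om) i j.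
Proof.
move=> cz.
have cst (c : C) : c @[s --> om] --> c by exact: cvg_cst.
have [c00 c10] := cvg_ivp (a := fun=> 1) (b := fun=> 0) (cst 1) (cst 0) cz N.
have [c01 c11] := cvg_ivp (a := fun=> 0) (b := fun=> 1) (cst 0) (cst 1) cz N.
have cT k : transfer s (z s) k j @[s --> om] --> transfer om (z om) k j.
  move: k j; do 2!apply: ord2P; rewrite /transfer mxE /=;
    under eq_fun do rewrite mxE /=.
  - exact: c00.
  - exact: c01.
  - exact: c10.
  - exact: c11.
have E s : charmx A B s (z s) i j =
    A i j + (B i 0 * transfer s (z s) 0 j + B i 1 * transfer s (z s) 1 j).
  by rewrite 2!mxE !big_ord_recl big_ord0 addr0 ord2_lift.
rewrite E (_ : (fun s => _) = fun s => A i j + (B i 0 * transfer s (z s) 0 j +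
  B i 1 * transfer s (z s) 1 j)); last by apply/funext => s; exact: E.
apply: (cvgD (cst _)); apply: cvgD; apply: (cvgM (cst _)); exact: cT.
Qed.

(** The kernel vector (a0, b0) at [om] is a multiple of [row_perp] for some row that
    does not vanish at [om].  Keeping the row and the factor while [s] varies
    gives the continuous choice of kernel vectors. *)
Lemma cvg_initial_data A B (z : slspace R N -> C) om (a0 b0 : C) :
  z s @[s --> om] --> z om ->
  charmx A B om (z om) != 0 -> charmx A B om (z om) *m state a0 b0 = 0 ->
  exists a b : slspace R N -> C,
  [/\ a om = a0, b om = b0, a s @[s --> om] --> a om, b s @[s --> om] --> b om &
      forall s, \det (charmx A B s (z s)) = 0 ->
        charmx A B s (z s) *m state (a s) (b s) = 0].
Proof.
move=> cz M0 Mc0.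
have [i Mi0] : exists i, row i (charmx A B om (z om)) != 0.
  apply/existsP; apply: contraNT M0 => /existsPn rows0; apply/eqP/row_matrixP => i.
  by rewrite row0; apply/eqP; have := rows0 i; rewrite negbK.
have [t ct] := kernel_row_perp Mi0 Mc0.
exists (fun s => t * - charmx A B s (z s) i 1).
exists (fun s => t * charmx A B s (z s) i 0).
have cst : t @[s --> om] --> t by exact: cvg_cst.
split.
- by move/matrixP: ct => /(_ 0 0); rewrite !mxE.
- by move/matrixP: ct => /(_ 1 0); rewrite !mxE.
- by apply: (cvgM cst); apply: cvgN; exact: cvg_charmx.
- by apply: (cvgM cst); exact: cvg_charmx.
move=> s detM; rewrite (_ : state _ _ = t *: row_perp (charmx A B s (z s)) i).
  by rewrite -scalemxAr mul_row_perp // scaler0.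
by apply/matrixP => k j; rewrite ord1 !mxE; move: k; apply: ord2P.
Qed.

(** The real part of the Lagrange identity between [y] and a perturbed solution
    [u], once the boundary terms have cancelled.  The formula is exact: the
    perturbed solution enters it only through the products of [y] with [u] and
    of the quasi-difference of [y] with [v].  Real parts are
    taken because the increment of the eigenvalue is real and, in the limit,
    these products become squared moduli. *)
Lemma eigenvalue_increment A B om sg (lam mu : R) y (u v : nat -> C) :
  Omega om -> selfadjoint_bc A B ->
  sl_equation om lam%:C y -> boundary_condition om A B y ->
  (forall n, (n < N)%N -> u n.+1 = u n + (rcoef sg n)%:C * v n) ->
  (forall n, (n < N)%N -> v n.+1 = v n +
    ((qcoef sg n.+1)%:C - mu%:C * (wcoef sg n.+1)%:C) * u n.+1) ->
  A *m state (u 0%N) (v 0%N) + B *m state (u N) (v N) = 0 ->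
  let yu n := complex.Re (conjc (y n) * u n) in
  let pv n := complex.Re (conjc (quasidiff om y n) * v n) in
  (mu - lam) * \sum_(1 <= n < N.+1) wcoef sg n * yu n =
  coordform (fun n => - pv n) yu (fun n => - lam * yu n) (sg - om).
Proof.
move=> Oom sa eqy bcy uE vE bcu yu pv.
pose yc n := conjc (y n); pose pc n := conjc (quasidiff om y n).
have ycE n : (n < N)%N -> yc n.+1 = yc n + (rcoef om n)%:C * pc n.
  move=> nN; rewrite /yc (seq_quasidiff _ Oom (ltnW nN)) rmorphD rmorphM.
  by congr (_ + _ * _); exact: conjc_real.
have pcE n : (n < N)%N -> pc n.+1 = pc n +
    (qcoef om n.+1 - lam * wcoef om n.+1)%:C * yc n.+1.
  move=> nN; rewrite /pc (quasidiff_step eqy nN) -[lam%:C * _]rmorphM -rmorphB.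
  rewrite [LHS]rmorphD [X in _ + X = _]rmorphM.
  by congr (_ + _ * _); exact: conjc_real.
have vE' n : (n < N)%N -> v n.+1 = v n +
    (qcoef sg n.+1 - mu * wcoef sg n.+1)%:C * u n.+1.
  by move=> nN; rewrite vE // rmorphB rmorphM.
have := green_identity
  (r := fun n => (rcoef om n)%:C) (s := fun n => (rcoef sg n)%:C)
  (Q := fun n => (qcoef om n - lam * wcoef om n)%:C)
  (Q' := fun n => (qcoef sg n - mu * wcoef sg n)%:C) ycE pcE uE vE'.
have formE (a b c d : C) :
    ((state a b) ^t* *m mx2 0 1 (-1) 0 *m state c d)%sesqui 0 0 =
    conjc a * d - conjc b * c.
  rewrite !mxE !big_ord_recl big_ord0 !mxE !big_ord_recl !big_ord0 !mxE /=.
  ring.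
have := selfadjoint_bc_form sa bcy bcu.
rewrite !bvec_state => /matrixP /(_ 0 0); rewrite !formE => ->; rewrite subrr.
move=> /(congr1 (@complex.Re R)).
have ReB (x1 x2 : R[i]) : complex.Re (x1 - x2) = complex.Re x1 - complex.Re x2.
  by case: x1; case: x2.
have ReM (r : R) (x : R[i]) : complex.Re (r%:C * x) = r * complex.Re x.
  by case: x => x1 x2 /=; rewrite mul0r subr0.
have ReS (F : nat -> C) m k :
    complex.Re (\sum_(m <= n < k) F n) = \sum_(m <= n < k) complex.Re (F n).
  by apply: (big_morph (@complex.Re R)) => // [[? ?] [? ?]].
rewrite ReB !ReS.
under eq_bigr do rewrite -rmorphB ReM -/(yu _).
under [X in _ = _ - X]eq_bigr do rewrite -rmorphB ReM -/(pv _).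
have rE : \sum_(0 <= n < N) - pv n * vcoord (sg - om).1.1 n =
    - \sum_(0 <= n < N) (rcoef sg n - rcoef om n) * pv n.
  by rewrite -sumrN; apply: eq_bigr => n _; rewrite vcoordB mulNr mulrC.
have -> : \sum_(1 <= n < N.+1)
      (qcoef sg n - mu * wcoef sg n - (qcoef om n - lam * wcoef om n)) * yu n =
    \sum_(1 <= n < N.+1) yu n * vcoord1 (sg - om).1.2 n
    + \sum_(1 <= n < N.+1) - lam * yu n * vcoord1 (sg - om).2 n
    - (mu - lam) * \sum_(1 <= n < N.+1) wcoef sg n * yu n.
  rewrite mulr_sumr -big_split -sumrB /=; apply: eq_bigr => n _.
  by rewrite /vcoord1 !vcoordB -/(vcoord1 _ n) /qcoef /wcoef /vcoord1; ring.
rewrite /coordform rE => e; lra.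
Qed.

End Perturbation.

Theorem theorem4p7 (R : realType) (N : nat) (A B : 'M[R[i]]_2)
    (om : slspace R N) (lam : R) (y : nat -> R[i])
    (U : set (slspace R N)) (Lambda : slspace R N -> R) :
  (2 <= N)%N ->
  selfadjoint_bc A B ->
  Omega om ->
  simple_eigenvalue om A B lam%:C ->
  eigenfunction om A B lam%:C y ->
  normalized om y ->
  simple_eigenvalue_branch A B om lam U Lambda ->
  differentiable Lambda om /\
  forall (h : 'rV[R]_N.+1) (k l : 'rV[R]_N),
    'd Lambda om (h, k, l) =
      - (\sum_(0 <= n < N) normc (quasidiff om y n) ^+ 2 * vcoord h n)
      + \sum_(1 <= n < N.+1) normc (y n) ^+ 2 * vcoord1 k n
      - lam * \sum_(1 <= n < N.+1) normc (y n) ^+ 2 * vcoord1 l n.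
Proof.
move=> _ sa Oom simple [_ eqy bcy] normy [[nU UO] _ ctsL Lom simpleU].
have cL : Lambda s @[s --> om] --> Lambda om.
  have := ctsL om; rewrite /continuous_at.
  by rewrite -(nbhs_subspace_interior nU).
pose z s : R[i] : numClosedFieldType := (Lambda s)%:C.
have cz : z s @[s --> om] --> z om by exact: cvg_real_complex.
have zom : z om = lam%:C by rewrite /z Lom.
have [_ M0] := simple_eigenvalue_charmx Oom simple.
have yE n := sl_equation_ivp (n := n) Oom eqy.
have My : charmx A B om (z om) *m state (y 0%N) (quasidiff om y 0) = 0.
  rewrite zom mulmxDl -mulmxA -transfer_ivp.
  by have [<- <-] := yE N (leqnn N); exact: bcy.
rewrite -zom in M0.
(* For [s] in [U], [u s] is a solution for [Lambda s] that satisfies the boundary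
   condition, and [v s] is its quasi-difference; [u om] is [y] itself. *)
have [a [b [aom bom ca cb Mc]]] := cvg_initial_data cz M0 My.
pose u s n := ivp_val s (a s) (b s) (z s) n.
pose v s n := ivp_mom s (a s) (b s) (z s) n.
have uom n : (n <= N)%N -> u om n = y n.
  by move=> nN; rewrite /u aom bom zom; have [] := yE n nN.
have vom n : (n <= N)%N -> v om n = quasidiff om y n.
  by move=> nN; rewrite /v aom bom zom; have [] := yE n nN.
pose yu s n := complex.Re (conjc (y n) * u s n).
pose pv s n := complex.Re (conjc (quasidiff om y n) * v s n).
pose S s := \sum_(1 <= n < N.+1) wcoef s n * yu s n.
have cyu n : yu s n @[s --> om] --> yu om n.
  apply: cvg_complex_Re; apply: cvgM; first exact: cvg_cst.
  exact: (proj1 (cvg_ivp ca cb cz n)).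
have cpv n : pv s n @[s --> om] --> pv om n.
  apply: cvg_complex_Re; apply: cvgM; first exact: cvg_cst.
  exact: (proj2 (cvg_ivp ca cb cz n)).
have cS : S s @[s --> om] --> S om.
  apply: cvg_big => [|n _]; first exact: add_continuous.
  by apply: cvgM; [exact: wcoef_cvg|exact: cyu].
have Som : S om = 1.
  rewrite -normy; apply: eq_big_nat => n /andP[_ nN].
  by rewrite /yu uom // Re_conj_mul.
have cSV : (S s)^-1 @[s --> om] --> (S om)^-1.
  by apply: cvgV => //; rewrite Som oner_neq0.
have nS : \forall s \near om, S s != 0.
  have S0 : S om != 0 by rewrite Som oner_neq0.
  exact: (cvgr_neq0 _ cS S0).
have LE : \forall s \near om, Lambda s - Lambda om =
    coordform (fun n => (S s)^-1 * - pv s n) (fun n => (S s)^-1 * yu s n)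
      (fun n => (S s)^-1 * (- lam * yu s n)) (s - om).
  near=> s.
  have Us : U s by near: s.
  have Ss : S s != 0 by near: s.
  have Os := UO _ Us.
  have [detM _] := simple_eigenvalue_charmx Os (simpleU _ Us).
  have := eigenvalue_increment (mu := Lambda s) (u := u s) (v := v s)
    Oom sa eqy bcy.
  rewrite -coordformZ /= => <-; last 3 first.
  - by move=> n _; exact: ivp_valS.
  - by move=> n _; exact: ivp_momS.
  - by rewrite /u /v ivp_val0 ivp_mom0; apply: charmx_ivp; exact: Mc.
  by rewrite Lom mulrCA mulVf // mulr1.
have [dL dE] : differentiable Lambda om /\ 'd Lambda om =
    coordform (fun n => (S om)^-1 * - pv om n) (fun n => (S om)^-1 * yu om n)
      (fun n => (S om)^-1 * (- lam * yu om n)) :> (_ -> _).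
  apply: (diff_moving_coordform
    (a := fun s n => (S s)^-1 * - pv s n) (b := fun s n => (S s)^-1 * yu s n)
    (c := fun s n => (S s)^-1 * (- lam * yu s n))) LE => n.
  - by apply: (cvgM cSV); apply: cvgN; exact: cpv.
  - by apply: (cvgM cSV); exact: cyu.
  - by apply: (cvgM cSV); apply: cvgM; [exact: cvg_cst|exact: cyu].
split=> // h k l; rewrite dE -coordformZ Som invr1 mul1r /coordform /=.
rewrite -sumrN -mulNr mulr_sumr.
congr (_ + _ + _); apply: eq_big_nat => n /andP[_ nN].
- by rewrite /pv vom ?(ltnW nN) // Re_conj_mul mulNr.
- by rewrite /yu uom // Re_conj_mul.
- by rewrite /yu uom // Re_conj_mul -[LHS]mulrA.
Unshelve. all: by end_near. Qed.
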